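(* Let $p$ be a prime and let $q\in\mathbb{C}_p$ with $q\neq 1$ and $|q-1|_p<p^{-1/(p-1)}$. For $n\in\mathbb{N}$ and $m\in\mathbb{Z}_{+}=\{0,1,2,\dots\}$, $$\binom{n}{m} = \sum_{k=m}^{n} (q-1)^{k-m} \begin{bmatrix} n \\ k\end{bmatrix}_{q} s_{1, q}(k, m),$$ where $s_{1,q}(k,m)$ are the $q$-Stirling numbers of the first kind.
   Context: $\mathbb{C}_p$ is the completion of an algebraic closure of $\mathbb{Q}_p$. Set $[x]_q=\frac{1-q^x}{1-q}$, $[n]_q!=\prod_{i=1}^n[i]_q$, and $\begin{bmatrix} n\\k\end{bmatrix}_q=\frac{[n]_q!}{[k]_q![n-k]_q!}$. Let $[x]_{k,q}=[x]_q[x-1]_q\cdots[x-k+1]_q$ (with $[x]_{0,q}=1$). The $q$-Stirling numbers of the first kind $s_{1,q}(k,l)$, $0\le l\le k$, are the numbers (independent of $x$) such that $[x]_{k,q}=q^{-\binom{k}{2}}\sum_{l=0}^{k}s_{1,q}(k,l)[x]_q^l$ for all $x$. *)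

(* Defs.v *)
From HB Require Import structures.
From mathcomp Require Import all_boot all_order all_algebra.
From mathcomp Require Import reals exp.

Set Implicit Arguments.
Unset Strict Implicit.
Unset Printing Implicit Defensive.

Import Order.TTheory GRing.Theory Num.Theory.
Local Open Scope ring_scope.

Definition nonarch_absval (R : realType) (F : fieldType) (v : F -> R) : Prop :=
  [/\ forall x, 0 <= v x,
      forall x, v x = 0 <-> x = 0,
      forall x y, v (x * y) = v x * v y &
      forall x y, v (x + y) <= Num.max (v x) (v y)].

Definition cauchy_for (R : realType) (F : fieldType) (v : F -> R)
    (u : nat -> F) : Prop :=
  forall e : R, 0 < e ->
    exists N : nat, forall m n : nat, (N <= m)%N -> (N <= n)%N ->
      v (u m - u n) < e.

Definition converges_for (R : realType) (F : fieldType) (v : F -> R)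
    (u : nat -> F) (l : F) : Prop :=
  forall e : R, 0 < e ->
    exists N : nat, forall n : nat, (N <= n)%N -> v (u n - l) < e.

(* (K, w) is the completion of (F, v) along the embedding i. *)
Definition is_completion (R : realType) (F : fieldType) (v : F -> R)
    (K : fieldType) (w : K -> R) (i : {rmorphism F -> K}) : Prop :=
  [/\ nonarch_absval w,
      forall x, w (i x) = v x,
      forall (y : K) (e : R), 0 < e -> exists x : F, w (y - i x) < e &
      forall u : nat -> K, cauchy_for w u -> exists l : K, converges_for w u l].

Definition is_algebraic_closure (F L : fieldType) (j : {rmorphism F -> L}) : Prop :=
  GRing.closed_field_axiom L /\ (forall y : L, algebraicOver j y).

(* Normalized by |p|_p = 1/p. *)
Definition padic_abs (R : realType) (p : nat) (x : rat) : R :=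
  if x == 0 then 0
  else (p%:R : R) ^ ((logn p `|denq x|%N)%:Z - (logn p `|numq x|%N)%:Z).

(* C_p is determined up to isometric isomorphism by its construction, and this
   record carries all the stages of that construction: Q_p as the completion of
   the rationals for the p-adic absolute value, an algebraic closure of Q_p with
   the absolute value extending that of Q_p, and the completion of the latter. *)
Record padicComplex (R : realType) (p : nat) := PadicComplex {
  Qp : fieldType;
  Qp_abs : Qp -> R;
  rat_to_Qp : {rmorphism rat -> Qp};
  Qp_completion : is_completion (padic_abs R p) Qp_abs rat_to_Qp;
  Qpbar : fieldType;
  Qpbar_abs : Qpbar -> R;
  Qp_to_Qpbar : {rmorphism Qp -> Qpbar};
  Qpbar_closure : is_algebraic_closure Qp_to_Qpbar;
  Qpbar_absval : nonarch_absval Qpbar_abs;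
  Qpbar_abs_ext : forall x : Qp, Qpbar_abs (Qp_to_Qpbar x) = Qp_abs x;
  Cp :> fieldType;
  Cp_abs : Cp -> R;
  Qpbar_to_Cp : {rmorphism Qpbar -> Cp};
  Cp_completion : is_completion Qpbar_abs Cp_abs Qpbar_to_Cp
}.

Definition qnum (K : fieldType) (q : K) (x : int) : K := (1 - q ^ x) / (1 - q).

Definition qfact (K : fieldType) (q : K) (n : nat) : K :=
  \prod_(1 <= i < n.+1) qnum q i%:Z.

Definition qbinom (K : fieldType) (q : K) (n k : nat) : K :=
  qfact q n / (qfact q k * qfact q (n - k)%N).

Definition qfalling (K : fieldType) (q : K) (x : int) (k : nat) : K :=
  \prod_(0 <= i < k) qnum q (x - i%:Z).

(* Integer values of x already determine s k l for l <= k when q is nonzero and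
   not a root of unity; values with k < l are left unconstrained. *)
Definition is_qstirling1 (K : fieldType) (q : K) (s : nat -> nat -> K) : Prop :=
  forall (k : nat) (x : int),
    qfalling q x k =
      (q ^+ 'C(k, 2))^-1 * \sum_(0 <= l < k.+1) s k l * qnum q x ^+ l.

(* Main.v *)
(* Put z = q^x = 1 + (q-1)[x]_q. The factors of (q-1)^k q^binom(k,2) [x]_{k,q}
   are z - q^i, so the defining expansion of s_{1,q} turns Cauchy's identity
   z^n = sum_k [n k]_q prod_{i<k} (z - q^i) into
     (1 + (q-1)X)^n = sum_k [n k]_q (q-1)^k sum_l s_{1,q}(k,l) X^l
   at X = [x]_q. These values are pairwise distinct for x = 0, 1, 2, ... because
   q is nonzero and not a root of unity, so the coefficients of X^m agree.

   To see that q is not a root of unity it is enough, by induction on the order,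
   to rule out x^l = 1 for l prime and x a power of q other than 1: with
   y = x - 1, the term l of ((1+y)^l - 1)/y = 0 has strictly larger absolute
   value than all the others, since |y|^(l-1) < |l| and l divides the inner
   binomial coefficients. *)
Require Import Defs.
From HB Require Import structures.
From mathcomp Require Import all_boot all_order all_algebra.
From mathcomp Require Import reals exp.
From mathcomp Require Import ring.

Set Implicit Arguments.
Unset Strict Implicit.
Unset Printing Implicit Defensive.

Import Order.TTheory GRing.Theory Num.Theory.
Local Open Scope ring_scope.

(** * Gaussian binomials and Cauchy's identity *)

(* Unlike [qbinom], whose value for k > n is junk (1/[n+1]_q at k = n+1), this
   version vanishes for k > n and so satisfies Pascal's rule everywhere. *)
Fixpoint gauss_binom (K : fieldType) (q : K) (n k : nat) : K :=
  match n, k with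
  | _, 0 => 1
  | 0, _.+1 => 0
  | n'.+1, k'.+1 => gauss_binom q n' k' + q ^+ k * gauss_binom q n' k
  end.

Lemma gauss_binom0 (K : fieldType) (q : K) n : gauss_binom q n 0 = 1.
Proof. by case: n. Qed.

Lemma gauss_binomSS (K : fieldType) (q : K) n k :
  gauss_binom q n.+1 k.+1 =
    gauss_binom q n k + q ^+ k.+1 * gauss_binom q n k.+1.
Proof. by []. Qed.

Lemma gauss_binom_small (K : fieldType) (q : K) n k :
  (n < k)%N -> gauss_binom q n k = 0.
Proof.
elim: n k => [|n IHn] [|k] //; rewrite ltnS => ltnk.
by rewrite gauss_binomSS !IHn ?mulr0 ?addr0 // ltnW.
Qed.

(** Induction on [n]. Pascal's rule yields two sums over the same products: one has the extra factor
    [z - q ^+ k], the other [q ^+ k], and together these give [z]. *)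
Lemma cauchy_binomial (K : fieldType) (q z : K) n :
  \sum_(k < n.+1) gauss_binom q n k * \prod_(i < k) (z - q ^+ i) = z ^+ n.
Proof.
elim: n => [|n IHn]; first by rewrite big_ord1 big_ord0 gauss_binom0 mulr1.
rewrite big_ord_recl gauss_binom0 big_ord0 mulr1 exprS -{}IHn.
under eq_bigr => i _ do rewrite lift0 gauss_binomSS mulrDl.
rewrite big_split /= [X in _ + (_ + X)]big_ord_recr /=.
rewrite gauss_binom_small // mulr0 mul0r addr0 addrCA.
(* The isolated 1 is the missing term [k = 0]. *)
have -> : 1 + \sum_(i < n) q ^+ i.+1 * gauss_binom q n i.+1 *
                \prod_(j < i.+1) (z - q ^+ j) =
          \sum_(k < n.+1) q ^+ k * gauss_binom q n k *
                \prod_(j < k) (z - q ^+ j).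
  by rewrite [RHS]big_ord_recl gauss_binom0 big_ord0 !mulr1.
rewrite -big_split mulr_sumr; apply: eq_bigr => k _ /=.
by rewrite big_ord_recr /=; ring.
Qed.

(** * The identity for nonzero q that is not a root of unity *)

Section NotRootOfUnity.
Variables (K : fieldType) (q : K).
Hypothesis q_nz : q != 0.
Hypothesis q_nroot : forall n, (0 < n)%N -> q ^+ n != 1.

Let q1_nz : 1 - q != 0.
Proof. by rewrite subr_eq0 eq_sym -[q]expr1 q_nroot. Qed.

Lemma qnum_neq0 n : (0 < n)%N -> qnum q n != 0.
Proof.
move=> n_gt0; rewrite mulf_neq0 ?invr_eq0 // subr_eq0 eq_sym.
exact: q_nroot.
Qed.

Lemma qfact_neq0 n : qfact q n != 0.
Proof.
rewrite /qfact big_seq prodf_seq_neq0; apply/allP => i; rewrite mem_index_iota.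
by case/andP=> i_gt0 _; apply/implyP => _; apply: qnum_neq0.
Qed.

Lemma qfactS n : qfact q n.+1 = qfact q n * qnum q n.+1.
Proof. by rewrite /qfact big_nat_recr. Qed.

(** Induction on [a + b] by Pascal's rule, using [a+b]_q = [a]_q + q^a [b]_q. Writing the upper
    index as [a + b] avoids truncated subtraction. *)
Lemma gauss_binom_qfact a b :
  gauss_binom q (a + b) a * (qfact q a * qfact q b) = qfact q (a + b).
Proof.
have fact0 : qfact q 0 = 1 by rewrite /qfact big_geq.
have [n] := ubnP (a + b); elim: n a b => // n IHn [|a] [|b] ltn.
- by rewrite gauss_binom0 fact0 !mul1r.
- by rewrite gauss_binom0 fact0 !mul1r.
- have /IHn : (a + 0 < n)%N by [].
  rewrite !addn0 fact0 gauss_binomSS (@gauss_binom_small _ _ a a.+1) // => IH.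
  by rewrite qfactS -{2}IH; ring.
have /IHn IH1 : (a + b.+1 < n)%N by [].
have /IHn IH2 : (a.+1 + b < n)%N by rewrite addSnnS.
move: IH1 IH2; rewrite !addSn !addnS (gauss_binomSS q (a + b).+1) !qfactS.
move=> IH1 IH2.
have num_add : qnum q (a + b).+2 = qnum q a.+1 + q ^+ a.+1 * qnum q b.+1.
  rewrite /qnum -!exprnP -[(a + b).+2]/(a.+1 + b).+1 -addnS exprD.
  by field.
move: (gauss_binom _ _ a) (gauss_binom _ _ a.+1) IH1 IH2 => g h IH1 IH2.
by rewrite num_add mulrDr -{1}IH1 -IH2; ring.
Qed.

Lemma qbinomE n k : (k <= n)%N -> qbinom q n k = gauss_binom q n k.
Proof.
move=> lekn; rewrite /qbinom -{1}(subnKC lekn) -gauss_binom_qfact subnKC //.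
by rewrite mulfK // mulf_neq0 ?qfact_neq0.
Qed.

Lemma qnum_inj : injective (fun n : nat => qnum q n).
Proof.
have lt_neq m n : (m < n)%N -> qnum q m <> qnum q n.
  move=> ltmn /(mulIf (invr_neq0 q1_nz)) /addrI /oppr_inj; rewrite -!exprnP.
  rewrite -(subnKC (ltnW ltmn)) exprD -{1}[q ^+ m]mulr1.
  move/(mulfI (expf_neq0 _ q_nz)) => /esym/eqP.
  by rewrite (negPf (q_nroot _)) ?subn_gt0.
move=> m n eqmn; case: (ltngtP m n) => // /lt_neq []; first exact: eqmn.
exact: esym.
Qed.

(** Factor by factor, q^x - q^i = q^i (q-1) [x-i]_q, and the powers q^i multiply to q^binom(k,2). *)
Lemma qfallingE (x k : nat) :
  (q - 1) ^+ k * q ^+ 'C(k, 2) * qfalling q x k =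
    \prod_(i < k) (q ^+ x - q ^+ i).
Proof.
elim: k => [|k IHk]; first by rewrite /qfalling big_geq // big_ord0 !mulr1.
rewrite big_ord_recr /= -IHk /qfalling big_nat_recr //= binS bin1 exprD exprS.
rewrite /qnum expfzDr // -exprnN -exprnP.
by field; rewrite q1_nz expf_neq0.
Qed.

Lemma poly_eq_on_qnum (f g : {poly K}) :
  (forall x : nat, f.[qnum q x] = g.[qnum q x]) -> f = g.
Proof.
move=> eq_fg; apply/eqP; rewrite -subr_eq0; apply/eqP.
set h := f - g.
apply: (@roots_geq_poly_eq0 _ _ [seq qnum q i%:Z | i <- iota 0 (size h)]).
- by apply/allP => _ /mapP[i _ ->]; rewrite rootE !hornerE eq_fg subrr.
- by rewrite map_inj_uniq ?iota_uniq //; apply: qnum_inj.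
- by rewrite size_map size_iota.
Qed.

Lemma bin_qstirling1 (s : nat -> nat -> K) (n m : nat) :
  is_qstirling1 q s ->
  ('C(n, m))%:R =
    \sum_(m <= k < n.+1) (q - 1) ^+ (k - m) * qbinom q n k * s k m.
Proof.
move=> sP.
have q1_nz' : q - 1 != 0 by rewrite -opprB oppr_eq0.
have polyE : (1 + (q - 1) *: 'X) ^+ n =
    \sum_(k < n.+1) ((q - 1) ^+ k * gauss_binom q n k) *:
      \poly_(l < k.+1) s k l.
  apply: poly_eq_on_qnum => x.
  have -> : ((1 + (q - 1) *: 'X) ^+ n).[qnum q x] = (q ^+ x) ^+ n.
    rewrite horner_exp hornerD hornerC hornerZ hornerX; congr (_ ^+ n).
    by rewrite /qnum -exprnP; field.
  rewrite -(cauchy_binomial q) horner_sum; apply: eq_bigr => k _.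
  rewrite hornerZ horner_poly -qfallingE sP big_mkord.
  by field; rewrite expf_neq0.
have /(congr1 (fun f : {poly K} => f`_m)) := polyE.
rewrite coef_sum addrC exprDn coef_sum.
(* After reversing the sum, the term of index [i] is a multiple of X^i, so only [i = m] contributes,
   and nothing does if [m > n]. *)
have -> : \sum_(i < n.+1) (((q - 1) *: 'X) ^+ (n - i) * 1 ^+ i *+ 'C(n, i))`_m
    = (q - 1) ^+ m * 'C(n, m)%:R :> K.
  rewrite (reindex_inj rev_ord_inj) /=.
  have termE (i : 'I_n.+1) : true ->
     (((q - 1) *: 'X) ^+ (n - (n.+1 - i.+1)) *
       1 ^+ (n.+1 - i.+1) *+ 'C(n, n.+1 - i.+1))`_m =
     if m == i then (q - 1) ^+ m * 'C(n, m)%:R else 0.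
    move=> _; have lein : (i <= n)%N by rewrite -ltnS.
    rewrite subSS subKn // bin_sub // expr1n mulr1 coefMn exprZn coefZ coefXn.
    by case: eqP => [->|_]; rewrite ?mulr1 ?mulr0 ?mul0rn // mulr_natr.
  rewrite (eq_bigr _ termE) -big_mkcond /=.
  have [ltmn|ltnm] := ltnP m n.+1.
    by rewrite (big_pred1 (Ordinal ltmn)) // => i; rewrite eq_sym.
  rewrite bin_small // mulr0 big_pred0 // => i.
  by rewrite gtn_eqF // (leq_trans _ ltnm).
move=> eq_coef; apply: (mulfI (expf_neq0 m q1_nz')); rewrite {}eq_coef.
rewrite mulr_sumr.
under eq_bigr => k _ do rewrite coefZ coef_poly ltnS.
rewrite -(big_mkord predT (fun k => (q - 1) ^+ k * gauss_binom q n k *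
  (if (m <= k)%N then s k m else 0))).
have [lemn|ltnm] := leqP m n.+1; last first.
  rewrite [RHS]big_geq ?(ltnW ltnm) // big_nat big1 // => k /andP[_ ltkn].
  by rewrite leqNgt (ltn_trans ltkn ltnm) mulr0.
rewrite (big_cat_nat (leq0n m) lemn) /= big_nat big1 ?add0r; last first.
  by move=> k /andP[_ ltkm]; rewrite leqNgt ltkm mulr0.
apply: eq_big_nat => k /andP[lemk ltkn].
by rewrite lemk qbinomE // -{1}(subnKC lemk) exprD -!mulrA.
Qed.

End NotRootOfUnity.

(** * Ultrametric estimates and roots of unity *)

Section NonArchimedean.
Variables (R : realType) (K : fieldType) (v : K -> R).
Hypothesis vP : nonarch_absval v.

Let v_ge0 x : 0 <= v x. Proof. by case: vP. Qed.
Let v_eq0 x : v x = 0 <-> x = 0. Proof. by case: vP. Qed.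
Let vM x y : v (x * y) = v x * v y. Proof. by case: vP. Qed.
Let vD x y : v (x + y) <= Num.max (v x) (v y). Proof. by case: vP. Qed.

Lemma absval0 : v 0 = 0. Proof. exact/v_eq0. Qed.

Lemma absval1 : v 1 = 1.
Proof.
have v1_nz : v 1 != 0 by apply/eqP => /v_eq0 /eqP; rewrite oner_eq0.
by apply: (mulfI v1_nz); rewrite -vM !mulr1.
Qed.

Lemma absvalX x n : v (x ^+ n) = v x ^+ n.
Proof. by elim: n => [|n IHn]; rewrite ?absval1 // !exprS vM IHn. Qed.

Lemma absvalN x : v (- x) = v x.
Proof.
have: v (-1) ^+ 2 == 1 by rewrite -absvalX sqrrN expr1n absval1.
rewrite sqrf_eq1 => /orP[] /eqP vN1; first by rewrite -mulN1r vM vN1 mul1r.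
by have := v_ge0 (-1); rewrite vN1 oppr_ge0 ler10.
Qed.

Lemma absval_sum_le (I : Type) (r : seq I) (P : pred I) (F : I -> K) c :
  0 <= c -> (forall i, P i -> v (F i) <= c) ->
  v (\sum_(i <- r | P i) F i) <= c.
Proof.
move=> c_ge0 Fc; apply: (big_ind (fun x => v x <= c)) => //.
  by rewrite absval0.
by move=> x y xc yc; rewrite (le_trans (vD x y)) // ge_max xc.
Qed.

Lemma absval_sum_lt (I : Type) (r : seq I) (P : pred I) (F : I -> K) c :
  0 < c -> (forall i, P i -> v (F i) < c) ->
  v (\sum_(i <- r | P i) F i) < c.
Proof.
move=> c_gt0 Fc; apply: (big_ind (fun x => v x < c)) => //.
  by rewrite absval0.
by move=> x y xc yc; rewrite (le_lt_trans (vD x y)) // gt_max xc.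
Qed.

Lemma absval_nat_le1 n : v n%:R <= 1.
Proof.
elim: n => [|n IHn]; first by rewrite absval0.
by rewrite mulrSr (le_trans (vD _ _)) // ge_max IHn absval1 lexx.
Qed.

Lemma absval_expr_sub1 x n : v (x - 1) < 1 -> v (x ^+ n - 1) <= v (x - 1).
Proof.
move=> x1_lt1; rewrite subrX1 vM ler_piMr // absval_sum_le // => i _.
rewrite absvalX exprn_ile1 // -(subrK 1 x) (le_trans (vD _ _)) //.
by rewrite absval1 ge_max (ltW x1_lt1) lexx.
Qed.

Lemma expr_prime_neq1 (l : nat) (x : K) :
  prime l -> x != 1 -> v (x - 1) < 1 -> v (x - 1) ^+ l.-1 < v l%:R ->
  x ^+ l != 1.
Proof.
(* From here on the prime is [l.+1]. *)
case: l => // l l_prime x_neq1 y_lt1 /= y_small; apply/eqP => xl1.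
set y := x - 1 in y_lt1 y_small.
have y_nz : y != 0 by rewrite subr_eq0.
have vl_gt0 : 0 < v l.+1%:R by rewrite (le_lt_trans _ y_small) // exprn_ge0.
have sum0 : \sum_(i < l.+1) y ^+ i *+ 'C(l.+1, i.+1) = 0.
  apply: (mulfI y_nz); rewrite mulr0 mulr_sumr.
  have : (y + 1) ^+ l.+1 - 1 = 0 by rewrite subrK xl1 subrr.
  rewrite addrC exprD1n big_ord_recl expr0 bin0 mulr1n addKr => {2}<-.
  by apply: eq_bigr => i _; rewrite lift0 exprS mulrnAr.
rewrite big_ord_recl expr0 bin1 in sum0.
move/eqP: sum0; rewrite addr_eq0 => /eqP /(congr1 v); rewrite absvalN => eq_vl.
suff : v l.+1%:R < v l.+1%:R by rewrite ltxx.
rewrite {1}eq_vl; apply: absval_sum_lt => // i _; rewrite lift0.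
have lei : (i.+2 <= l.+1)%N by rewrite ltnS ltn_ord.
rewrite -mulr_natr vM absvalX.
(* The top term is a bare power of [y], small by hypothesis. Every other term has a binomial
   coefficient divisible by the prime and a positive power of [y]. *)
move: lei; rewrite leq_eqVlt => /orP[/eqP [eq_il]|lti].
  by rewrite eq_il binn absval1 mulr1.
have /dvdnP[c ->] := prime_dvd_bin l_prime (lti : (0 < i.+2 < _)%N).
rewrite natrM vM mulrA gtr_pMl // (le_lt_trans _ y_lt1) //.
rewrite -[leRHS]mulr1 ler_pM ?exprn_ge0 ?absval_nat_le1 //.
by rewrite exprS ler_piMr // exprn_ile1 // ltW.
Qed.

(** Strong induction: for l the least prime factor of n, the power x^(n/l) is not 1 and lies at
    least as close to 1 as x, so it inherits the smallness conditions of the prime case. *)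
Lemma expr_neq1 (x : K) :
  x != 1 -> v (x - 1) < 1 ->
  (forall l, prime l -> v (x - 1) ^+ l.-1 < v l%:R) ->
  forall n, (0 < n)%N -> x ^+ n != 1.
Proof.
move=> x_neq1 x1_lt1 x_small n; have [k] := ubnP n.
elim: k n => // k IHk n ltnk n_gt0.
have [n_le1|n_gt1] := leqP n 1; first by rewrite (@anti_leq n 1) ?n_le1 ?expr1.
have l_prime := pdiv_prime n_gt1.
have def_n := divnK (pdiv_dvd n); rewrite -def_n exprM.
have le_x1 := absval_expr_sub1 (n %/ pdiv n) x1_lt1.
apply: expr_prime_neq1 => //.
- apply: IHk; last by rewrite divn_gt0 ?prime_gt0 // pdiv_leq.
  by rewrite (leq_trans (ltn_Pdiv _ _)) // prime_gt1.
- exact: le_lt_trans x1_lt1.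
- by rewrite (le_lt_trans _ (x_small _ l_prime)) // lerXn2r ?nnegrE.
Qed.

End NonArchimedean.

(** * Absolute values of integers in C_p, and the theorem *)

Lemma padic_abs_nat (R : realType) (p n : nat) : (0 < n)%N ->
  padic_abs R p n%:R = (p%:R ^+ logn p n)^-1.
Proof.
move=> n_gt0; rewrite /padic_abs pnatr_eq0 gtn_eqF // (pmulrn (1 : rat)).
by rewrite numq_int denq_int /= logn1 sub0r -exprnN.
Qed.

Lemma Cp_abs_nat (R : realType) (p : nat) (C : padicComplex R p) n :
  (0 < n)%N -> Cp_abs (n%:R : Cp C) = (p%:R ^+ logn p n)^-1.
Proof.
move=> n_gt0; rewrite -padic_abs_nat //.
have [_ CpE _ _] := Cp_completion C; have [_ QpE _ _] := Qp_completion C.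
by rewrite -QpE -Qpbar_abs_ext -CpE !rmorph_nat.
Qed.

Theorem theorem5 (R : realType) (p : nat) (p_prime : prime p)
    (C : padicComplex R p) (q : Cp C) (q_neq1 : q != 1)
    (q_close : Cp_abs (q - 1) < p%:R `^ (- (1 / (p%:R - 1))))
    (s1 : nat -> nat -> Cp C) (s1P : is_qstirling1 q s1) (n m : nat) :
  ('C(n, m))%:R =
    \sum_(m <= k < n.+1) (q - 1) ^+ (k - m) * qbinom q n k * s1 k m.
Proof.
have [absP _ _ _] := Cp_completion C; have [abs_ge0 _ _ _] := absP.
have p_gt1 := prime_gt1 p_prime.
have p1E : p%:R - 1 = p.-1%:R :> R by rewrite -subn1 natrB // ltnW.
have p1_gt0 : 0 < p.-1%:R :> R by rewrite ltr0n -ltnS prednK // ltnW.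
have radiusX : (p%:R `^ (- (1 / (p%:R - 1)))) ^+ p.-1 = p%:R^-1 :> R.
  rewrite -powR_mulrn ?powR_ge0 // -powRrM p1E mul1r mulNr mulVf ?gt_eqF //.
  by rewrite powR_inv1.
have q1_small : Cp_abs (q - 1) ^+ p.-1 < p%:R^-1.
  by rewrite -radiusX ltrXn2r ?nnegrE ?powR_ge0 ?abs_ge0 // -lt0n -(ltr0n R).
have q1_lt1 : Cp_abs (q - 1) < 1.
  rewrite ltNge; apply: contraTN q1_small => q1_ge1; rewrite -leNgt.
  by rewrite (le_trans _ (exprn_ege1 _ q1_ge1)) // invf_le1 ?ler1n ?ltr0n ltnW.
have q_nz : q != 0.
  by apply: contraTneq q1_lt1 => ->; rewrite sub0r absvalN // absval1 // ltxx.
apply: bin_qstirling1 => //; apply: (expr_neq1 absP) => // l l_prime.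
rewrite Cp_abs_nat ?prime_gt0 // logn_prime //.
(* For l = p the bound |q-1|^(p-1) < 1/p = |p| is exactly the radius condition; for l other than p,
   |l| = 1 and |q-1| < 1 suffices. *)
have [<-|_] := eqVneq p l; first by rewrite expr1.
rewrite invr1 exprn_ilt1 // -lt0n.
by rewrite -ltnS prednK ?prime_gt1 ?prime_gt0.
Qed.
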